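(* Suppose that $V$ is finite. Let $a\neq b$ be vertices of $V$ and suppose the transition probabilities satisfy $p(b,a)=1$. Let $k(v):=\mathbb{E}_v T_b$ for $v\in V$, assumed finite for all $v$, and let $$K_2:=\max_{v\in V} k(v)+\frac12\sum_{u\in V\setminus\{b\},\ v\in V} d(u)\,p(u,v)\,|k(u)-k(v)-1|.$$ Then for any rotor walk $x_0,x_1,\ldots$ associated with this chain (any initial vertex and any initial rotor configuration), and all $t$ with $n_t(b)>0$, $$\left|(k(a)+1)-\frac{t}{n_t(b)} \right|\leq \frac{K_2}{n_t(b)}.$$
   Context: Markov chain: $p:V\times V\to[0,1]$ are the transition probabilities of a Markov chain $X_0,X_1,\ldots$ on $V$; all $p(u,v)$ are rational. $\mathbb{E}_u$ is expectation for the chain started at $X_0=u$. $T_v:=\min\{t\ge 0: X_t=v\}$, with $\min\emptyset:=\infty$. Rotor mechanism: to each vertex $u$ are associated a positive integer $d(u)$ and a finite sequence of (not necessarily distinct) vertices $u^{(1)},\ldots,u^{(d(u))}$ (the successors of $u$) such that $p(u,v)=\#\{i:u^{(i)}=v\}/d(u)$ for all $u,v\in V$. Rotor walk: a rotor configuration is a map $r$ assigning to each $v\in V$ an integer $r(v)\in\{1,\ldots,d(v)\}$. Given an initial vertex $x_0$ and an initial rotor configuration $r_0$, the rotor walk is defined inductively: $r_{t+1}(v)=r_t(v)$ for $v\ne x_t$; $r_{t+1}(x_t)=r_t(x_t)+1$ if $r_t(x_t)<d(x_t)$ and $r_{t+1}(x_t)=1$ if $r_t(x_t)=d(x_t)$;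 and $x_{t+1}:=(x_t)^{(r_{t+1}(x_t))}$. $n_t(v):=\#\{s\in\{0,\ldots,t-1\}: x_s=v\}$. (The condition $p(b,a)=1$ may be imposed on any given chain by modifying the transitions out of $b$; this does not change $k$.) *)

(* Defs.v *)
From HB Require Import structures.
From mathcomp Require Import all_boot all_order all_algebra.
From mathcomp Require Import all_classical all_reals all_analysis.

Set Implicit Arguments.
Unset Strict Implicit.
Unset Printing Implicit Defensive.

Import Order.TTheory GRing.Theory Num.Theory.

Local Open Scope classical_set_scope.
Local Open Scope ring_scope.

Section MarkovChain.
Context {R : realType} {V : finType}.

Record transition_probabilities (p : V -> V -> R) : Prop := {
  transition_itv : forall u v, 0 <= p u v <= 1;
  transition_sum : forall u, \sum_v p u v = 1;
  transition_rational : forall u v, rational (p u v)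
}.

Context {disp : measure_display} {Omega : measurableType disp}.

(* [P u] is the law of the chain started at [u]. The Markov property is stated
   in product form, so that no conditioning on null events is needed. *)
Record markov_chain (p : V -> V -> R) (P : V -> probability Omega R)
    (X : nat -> Omega -> V) : Prop := {
  markov_measurable : forall t v, measurable [set w | X t w = v];
  markov_start : forall u, P u [set w | X 0%N w = u] = 1%E;
  markov_step : forall u t (s : nat -> V),
    P u [set w | forall i, (i <= t.+1)%N -> X i w = s i] =
    (P u [set w | forall i, (i <= t)%N -> X i w = s i]
      * (p (s t) (s t.+1))%:E)%E
}.

(* The infimum of the empty set in [\bar R] is [+oo]. *)
Definition hitting_time (X : nat -> Omega -> V) (b : V) (w : Omega) : \bar R :=
  ereal_inf [set (t%:R)%:E | t in [set t : nat | X t w = b]].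

Definition expected_hitting_time (P : V -> probability Omega R)
    (X : nat -> Omega -> V) (b v : V) : \bar R :=
  (\int[P v]_w hitting_time X b w)%E.

End MarkovChain.

Section RotorWalk.
Context {R : realType} {V : finType}.

Record rotor_mechanism (p : V -> V -> R) := RotorMechanism {
  rotor_deg : V -> nat;
  rotor_deg_gt0 : forall u, (0 < rotor_deg u)%N;
  rotor_succ : forall u, (rotor_deg u).-tuple V;
  rotor_succP : forall u v,
    p u v = (count_mem v (rotor_succ u))%:R / (rotor_deg u)%:R
}.

Context {p : V -> V -> R} (m : rotor_mechanism p).

(* Rotor positions are numbered from 1, whereas [nth] counts from 0; the
   default value [u] is not reached when [1 <= i <= rotor_deg m u]. *)
Definition successor (u : V) (i : nat) : V := nth u (rotor_succ m u) i.-1.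

Definition rotor_config (r : V -> nat) : Prop :=
  forall v, (1 <= r v <= rotor_deg m v)%N.

Definition rotor_step (c : V * (V -> nat)) : V * (V -> nat) :=
  let: (x, r) := c in
  let i := if (r x < rotor_deg m x)%N then (r x).+1 else 1%N in
  (successor x i, fun v => if v == x then i else r v).

Definition rotor_walk (x0 : V) (r0 : V -> nat) (t : nat) : V :=
  (iter t rotor_step (x0, r0)).1.

End RotorWalk.

Definition visits {V : finType} (x : nat -> V) (t : nat) (v : V) : nat :=
  #|[set s : 'I_t | x s == v]|.

Section Discrepancy.
Context {R : realType} {V : finType} {p : V -> V -> R}.

(* The base value [k b] of the iterated maximum is one of the values of [k]. *)
Definition K2 (m : rotor_mechanism p) (k : V -> R) (b : V) : R :=
  \big[Num.max/k b]_(v : V) k v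
  + 2%:R^-1 * \sum_(u : V | u != b) \sum_(v : V)
      (rotor_deg m u)%:R * p u v * `|k u - k v - 1|.

End Discrepancy.

(* Main.v *)
(** First-step analysis gives [k b = 0] and [k u = 1 + \sum_v p u v * k v] for
    [u != b]. Hence for [u != b] the increments [k u - k v - 1] sum to zero over
    one full turn of the rotor at [u], and their partial sum up to the current
    rotor position is a bounded function of the rotor configuration. Adding
    these partial sums to [k] of the current vertex gives a potential that
    increases by [k a] at each visit to [b] and decreases by [1] at every other
    step, so that after [t] steps it has changed by [n (k a + 1) - t]. *)

Require Import Defs.
From HB Require Import structures.
From mathcomp Require Import all_boot all_order all_algebra.
From mathcomp Require Import all_classical all_reals all_analysis.
From mathcomp Require Import measurable_realfun ring lra.

Set Implicit Arguments.
Unset Strict Implicit.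
Unset Printing Implicit Defensive.

Import Order.TTheory GRing.Theory Num.Theory.

Local Open Scope ring_scope.

(** * Expected hitting times as series of avoidance probabilities *)

Section HittingTime.
Context {R : realType} {V : finType} {p : V -> V -> R}.
Context {disp : measure_display} {Omega : measurableType disp}.
Variables (P : V -> probability Omega R) (X : nat -> Omega -> V) (b : V).
Hypothesis p_ge0 : forall u v, 0 <= p u v.
Hypothesis chain : markov_chain p P X.
Local Open Scope classical_set_scope.

Definition follows (s : nat -> V) (t : nat) : set Omega :=
  [set w | forall i, (i <= t)%N -> X i w = s i].

(** The window of times is half-open, so [avoids 0 n.+1] is the event that the hitting time of [b]
    exceeds [n]. *)
Definition avoids (t n : nat) : set Omega :=
  [set w | forall i, (t <= i < t + n)%N -> X i w <> b].

(** Probability that the chain started at [v] avoids [b] at times [1] to [n]. Time [0] is not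
    tested, so the value at [v = b] need not vanish for [n > 0]. *)
Fixpoint avoid_prob (n : nat) (v : V) : R :=
  if n is n'.+1 then \sum_(w | w != b) p v w * avoid_prob n' w else 1.

Lemma avoid_prob_ge0 (n : nat) (v : V) : 0 <= avoid_prob n v.
Proof.
elim: n v => [|n IHn] v /=; first exact: ler01.
by apply: sumr_ge0 => w _; rewrite mulr_ge0.
Qed.

Lemma measurable_follows (s : nat -> V) (t : nat) : measurable (follows s t).
Proof.
have -> : follows s t =
    \bigcap_(i in [set i | (i <= t)%N]) [set w | X i w = s i].
  by apply/seteqP; split => w /= H i; exact: H.
apply: bigcap_measurable => [|i _]; first by exists 0%N.
exact: markov_measurable chain _ _.
Qed.

Lemma measurable_avoids (t n : nat) : measurable (avoids t n).
Proof.
have -> : avoids t n =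
    \bigcap_i (if (t <= i < t + n)%N then ~` [set w | X i w = b] else setT).
  apply/seteqP; split => w /= H i; last by move=> ti; have := H i I; rewrite ti.
  by move=> _; case: ifP => // ti; exact: H.
apply: bigcapT_measurable => i; case: ifP => // _.
apply: measurableC; exact: markov_measurable chain _ _.
Qed.

Lemma measure_partition (mu : probability Omega R) (Y : Omega -> V)
    (A : set Omega) :
  measurable A -> (forall v, measurable [set w | Y w = v]) ->
  (mu A = \sum_v mu (A `&` [set w | Y w = v]))%E.
Proof.
move=> mA mY.
have {1}-> : A = \bigcup_(v in [set: V]) (A `&` [set w | Y w = v]).
  by apply/seteqP; split => [w Aw|w [v _ []]]//; exists (Y w).
rewrite measure_fin_bigcup; [|exact: finite_finset| |].
- rewrite (@fsbigE _ _ _ _ _ (index_enum V)) ?index_enum_uniq//.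
    by apply: eq_bigl => v; rewrite in_setT.
  by move=> v _; rewrite mem_index_enum.
- by move=> u v _ _ [w [[_ <-] [_ <-]]].
- by move=> v _; exact: measurableI.
Qed.

(* The prefix [s] is arbitrary so that, in the induction on [n], it can be
   extended by the value of [X t.+1]. *)
Lemma prob_follows_avoids (u : V) (s : nat -> V) (t n : nat) :
  P u (follows s t `&` avoids t.+1 n) =
  (P u (follows s t) * (avoid_prob n (s t))%:E)%E.
Proof.
elim: n s t => [|n IHn] s t.
  rewrite /= mule1; congr (P u _); apply/seteqP; split => w; first by case.
  by move=> sw; split=> // i; rewrite addn0 ltnNge andNb.
rewrite (@measure_partition (P u) (X t.+1)); last first.
- by move=> v; exact: markov_measurable chain _ _.
- by apply: measurableI; [exact: measurable_follows|exact: measurable_avoids].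
(* The event already excludes [b] at time [t.+1], so the term for [b] is zero, matching the
   restricted sum in [avoid_prob]. *)
rewrite (bigD1 b)//= [X in (P u X + _)%E](_ : _ = set0) ?measure0 ?add0e;
  last first.
  apply/seteqP; split => // w [[_ /(_ t.+1)]].
  by rewrite leqnn addnS ltnS leq_addr => /(_ isT).
rewrite -sumEFin ge0_sume_distrr; last first.
  by move=> w _; rewrite lee_fin mulr_ge0// avoid_prob_ge0.
apply: eq_bigr => v vb.
pose s' i := if i == t.+1 then v else s i.
have s't i : (i <= t)%N -> s' i = s i.
  by move=> it; rewrite /s' ltn_eqF.
have s'S : s' t.+1 = v by rewrite /s' eqxx.
transitivity (P u (follows s' t.+1 `&` avoids t.+2 n)).
  congr (P u _); apply/seteqP; split => w /=.
    move=> [[sw aw] vw]; split=> i.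
      rewrite leq_eqVlt => /orP[/eqP->|]; first by rewrite s'S.
      by rewrite ltnS => it; rewrite s't// sw.
    by move=> /andP[ti it]; apply: aw; rewrite (ltnW ti) addnS.
  move=> [sw aw]; split; last by rewrite sw.
  split=> i; first by move=> it; rewrite sw ?s't// leqW.
  rewrite leq_eqVlt => /andP[/orP[/eqP<- _|ti it]].
    by rewrite sw// s'S; exact/eqP.
  by apply: aw; rewrite ti addSnnS.
rewrite IHn (markov_step chain) -/(follows s' t) s'S s't// -muleA -EFinM.
congr (P u _ * _)%E; apply/seteqP.
by split => w sw i it; rewrite sw// s't.
Qed.

Lemma prob_start_ne (u v : V) : v != u -> P u [set w | X 0%N w = v] = 0%E.
Proof.
move=> vu; apply/eqP; rewrite eq_le measure_ge0 andbT.
rewrite -[leRHS](subee (_ : 1%E \is a fin_num))//.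
have mX w := markov_measurable chain 0%N w.
rewrite -{2}(markov_start chain u) -probability_setC//.
apply: le_measure; rewrite ?inE//; first exact: measurableC.
by move=> w /= ->; exact/eqP.
Qed.

(** Here time [0] is tested as well, which makes the case [u = b] separate; otherwise the prefix of
    length one fixes the start and the previous product formula applies. *)
Lemma prob_avoids0 (u : V) (n : nat) :
  P u (avoids 0 n.+1) = if u == b then 0%E else (avoid_prob n u)%:E.
Proof.
have mX w := markov_measurable chain 0%N w.
rewrite (@measure_partition (P u) (X 0%N))//; last exact: measurable_avoids.
rewrite (bigD1 u)//= big1 ?adde0; last first.
  move=> v vu; apply/eqP; rewrite eq_le measure_ge0 andbT -(prob_start_ne vu).
  apply: le_measure; rewrite ?inE//; apply: measurableI => //.
  exact: measurable_avoids.
case: eqP => [->|/eqP ub].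
  rewrite [X in P b X](_ : _ = set0) ?measure0//.
  by apply/seteqP; split => // w [/(_ 0%N isT)].
rewrite -[RHS]mul1e -(markov_start chain u).
rewrite [X in (P u X * _)%E](_ : _ = follows (fun=> u) 0); last first.
  apply/seteqP; split => w /=; [move=> ? i|apply]; rewrite ?leqn0//.
  by move=> /eqP->.
rewrite -prob_follows_avoids; congr (P u _); apply/seteqP; split => w /=.
  move=> [aw uw]; split=> [i|i /andP[_ it]]; last exact: aw.
  by rewrite leqn0 => /eqP->.
move=> [sw aw]; split; last exact: sw.
case=> [_|i it]; last exact: aw.
by rewrite sw//; exact/eqP.
Qed.

(* The tail-sum formula, valid also when [b] is never hit. *)
Lemma hitting_timeE (w : Omega) :
  hitting_time (R := R) X b w = (\sum_(n <oo) (\1_(avoids 0 n.+1) w)%:E)%E.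
Proof.
have ind_ge0 n : (0 <= (\1_(avoids 0 n.+1) w : R)%:E)%E by rewrite lee_fin.
have sum1 N : (forall n, (n < N)%N -> X n w <> b) ->
    (\sum_(0 <= n < N) (\1_(avoids 0 n.+1) w)%:E = (N%:R : R)%:E)%E.
  move=> Nw; rewrite sumEFin (eq_big_nat _ _ (F2 := fun=> 1)); last first.
    move=> n /andP[_ nN]; rewrite indicE mem_set// => i /= ni.
    by apply: Nw; rewrite (leq_trans ni).
  by rewrite big_const_nat subn0 iter_addr_0.
(* If [b] is first hit at time [N], the indicators are 1 below [N] and 0 from [N] on. *)
have [[N0 /eqP hN0]|nohit] := pselect (exists n, X n w = b).
  have exN : exists n, X n w == b by exists N0.
  case: (find_ex_minn exN) => N /eqP hN minN.
  rewrite (@nneseries_split _ _ _ N)//= add0n sum1; last first.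
    by move=> n nN /eqP /minN; rewrite leqNgt nN.
  rewrite eseries0 ?adde0; last first.
    move=> n Nn _; rewrite indicE memNset// => /(_ N).
    by rewrite add0n ltnS => /(_ Nn).
  apply/eqP; rewrite eq_le; apply/andP; split.
    by apply: ereal_inf_lbound; exists N.
  apply: le_ereal_inf_tmp => _ [n /= /eqP /minN Nn <-].
  by rewrite lee_fin ler_nat.
rewrite /hitting_time [X in ereal_inf X](_ : _ = set0); last first.
  by apply/seteqP; split => // _ [n /= hn _]; apply: nohit; exists n.
(* Without a hit every indicator is 1, so the partial sum up to a natural number above [A] exceeds
   [A]. *)
rewrite ereal_inf0; apply/esym/eqyP => A A0.
rewrite (@nneseries_split _ _ _ (Num.bound A))//= add0n sum1; last first.
  by move=> n _ hn; apply: nohit; exists n.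
apply: (@le_trans _ _ ((Num.bound A)%:R : R)%:E).
  by rewrite lee_fin ltW// archi_boundP// ltW.
by rewrite leeDl// nneseries_ge0.
Qed.

(** The tail-sum formula is integrated term by term, which nonnegativity permits. *)
Lemma expected_hitting_timeE (u : V) :
  expected_hitting_time P X b u =
  if u == b then 0%E else (\sum_(n <oo) (avoid_prob n u)%:E)%E.
Proof.
rewrite /expected_hitting_time; under eq_integral do rewrite hitting_timeE.
rewrite integral_nneseries//; last first.
  move=> n; apply/measurable_EFinP; apply: measurable_indic.
  exact: measurable_avoids.
have prob_ind n : (\int[P u]_w (\1_(avoids 0 n.+1) w)%:E)%E =
    if u == b then 0%E else (avoid_prob n u)%:E.
  rewrite integral_indic//; last exact: measurable_avoids.
  by rewrite setIT -prob_avoids0.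
under eq_eseriesr do rewrite prob_ind.
by case: eqP => // _; exact: eseries0.
Qed.

Lemma expected_hitting_time_ge0 (u : V) :
  (0 <= expected_hitting_time P X b u)%E.
Proof.
rewrite expected_hitting_timeE; case: eqP => // _.
by apply: nneseries_ge0 => n _ _; rewrite lee_fin avoid_prob_ge0.
Qed.

(** First-step analysis in the extended reals: the first term of the series is 1, and the recursion
    for [avoid_prob] expands all the others. *)
Lemma expected_hitting_time_step (u : V) : u != b ->
  (expected_hitting_time P X b u =
   1 + \sum_v (p u v)%:E * expected_hitting_time P X b v)%E.
Proof.
move=> ub; rewrite [LHS]expected_hitting_timeE (negbTE ub).
have q_ge0 n v : (0 <= (avoid_prob n v)%:E)%E by rewrite lee_fin avoid_prob_ge0.
rewrite nneseries_recl//= -nneseries_addn//; congr (_ + _)%E.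
under eq_eseriesr => n _.
  rewrite addn1 /= -sumEFin.
  under eq_bigr do rewrite EFinM.
  over.
rewrite nneseries_sum; last by move=> v n _; rewrite mule_ge0// lee_fin.
(* The recursion sums over [w != b] only; the missing term is zero because the expected hitting time
   from [b] is. *)
rewrite [RHS](bigD1 b)//= {1}expected_hitting_timeE eqxx mule0 add0e.
apply: eq_bigr => v vb.
by rewrite nneseriesZl// expected_hitting_timeE (negbTE vb).
Qed.

End HittingTime.

(** * Sums over lists and partial sums of zero-sum lists *)

Section FiniteSums.
Context {R : realFieldType}.

Lemma sum_count_mem (V : finType) (s : seq V) (f : V -> R) :
  \sum_(v <- s) f v = \sum_v (count_mem v s)%:R * f v.
Proof.
elim: s => [|w s IHs]; first by rewrite big_nil big1// => v _; rewrite mul0r.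
rewrite big_cons IHs /=.
under [RHS]eq_bigr do rewrite natrD mulrDl.
rewrite big_split /=; congr (_ + _).
rewrite (bigD1 w)//= eqxx mul1r big1 ?addr0// => v /negbTE.
by rewrite eq_sym => ->; rewrite mul0r.
Qed.

(* The terms between two positions of a zero-sum sequence and the remaining
   terms have opposite sums, so twice the former is at most the total mass. *)
Lemma norm_sum_take_sub (T : Type) (s : seq T) (f : T -> R) (i j : nat) :
  \sum_(x <- s) f x = 0 ->
  `|\sum_(x <- take i s) f x - \sum_(x <- take j s) f x|
    <= 2%:R^-1 * \sum_(x <- s) `|f x|.
Proof.
wlog le_ji : i j / (j <= i)%N.
  by move=> H; case/orP: (leq_total j i) => ? ?; [|rewrite distrC]; exact: H.
move=> s0.
have take_i : take i s = take j s ++ take (i - j) (drop j s).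
  by rewrite take_drop subnK// -(take_takel s le_ji) cat_take_drop.
move: s0; rewrite -{1 4}(cat_take_drop i s) take_i !big_cat/=.
have nA := ler_norm_sum (take j s) f predT.
have nB := ler_norm_sum (take (i - j) (drop j s)) f predT.
have nC := ler_norm_sum (drop i s) f predT.
move: nA nB nC.
set A := \sum_(x <- take j s) f x; set B := \sum_(x <- take _ (drop _ _)) f x.
set C := \sum_(x <- drop i s) f x => nA nB nC ABC.
have BE : `|A + B - A| = `|A + C|.
  by rewrite -normrN; congr `|_|; lra.
have := ler_normD A C.
rewrite -BE; have : `|A + B - A| = `|B| by congr `|_|; ring.
lra.
Qed.

End FiniteSums.

(** * Visit counts *)

Lemma visitsE (V : finType) (x : nat -> V) (t : nat) (v : V) :
  visits x t v = (\sum_(s < t) (x s == v))%N.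
Proof.
rewrite /visits -sum1_card big_mkcond; apply: eq_bigr => s _ /=.
have -> : (s \in [set s : 'I_t | x s == v]%classic) = (x s == v).
  by apply/idP/idP; rewrite inE.
by case: (x s == v).
Qed.

Lemma visits0 (V : finType) (x : nat -> V) (v : V) : visits x 0 v = 0%N.
Proof. by rewrite visitsE big_ord0. Qed.

Lemma visitsS (V : finType) (x : nat -> V) (t : nat) (v : V) :
  visits x t.+1 v = (visits x t v + (x t == v))%N.
Proof. by rewrite !visitsE big_ord_recr. Qed.

(** * The potential of the rotor walk *)

Section RotorPotential.
Context {R : realType} {V : finType} {p : V -> V -> R}.
Variable m : rotor_mechanism p.

Lemma sum_rotor_succ (u : V) (f : V -> R) :
  \sum_(v <- rotor_succ m u) f v = (rotor_deg m u)%:R * \sum_v p u v * f v.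
Proof.
rewrite sum_count_mem mulr_sumr; apply: eq_bigr => v _.
rewrite (rotor_succP m) mulrA [(rotor_deg m u)%:R * _]mulrC divfK//.
by rewrite pnatr_eq0 -lt0n rotor_deg_gt0.
Qed.

Lemma successor_mem (u : V) (i : nat) :
  (1 <= i <= rotor_deg m u)%N -> successor m u i \in rotor_succ m u.
Proof.
by case/andP => i0 id; rewrite mem_nth// size_tuple prednK.
Qed.

(** Transition probability 1 forces every entry of the successor list to be [v]. *)
Lemma successor_eq1 (u v : V) (i : nat) :
  p u v = 1 -> (1 <= i <= rotor_deg m u)%N -> successor m u i = v.
Proof.
move=> puv /successor_mem; set s := successor m u i => us; apply/eqP.
suff /allP/(_ _ us) : all (pred1 v) (rotor_succ m u) by [].
rewrite all_count size_tuple -(eqr_nat R); apply/eqP.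
move: puv; rewrite (rotor_succP m) => /divr1_eq.
by [].
Qed.

Lemma rotor_step_config (c : V * (V -> nat)) :
  rotor_config m c.2 -> rotor_config m (rotor_step m c).2.
Proof.
case: c => x r /= rc v; case: eqP => [->|_]; last exact: rc.
by have [|_] := ltnP (r x) (rotor_deg m x); rewrite ?(rotor_deg_gt0 m).
Qed.

Lemma rotor_walk_config (x0 : V) (r0 : V -> nat) (t : nat) :
  rotor_config m r0 -> rotor_config m (iter t (rotor_step m) (x0, r0)).2.
Proof. by move=> rc; elim: t => //= t; exact: rotor_step_config. Qed.

(** For [u != b] a step of the chain lowers [k] by 1 on average; this is the deviation of the step
    from [u] to [v] from that mean. *)
Definition defect (k : V -> R) (u v : V) : R := k u - k v - 1.

(** Positions count from 1, so the partial sum includes the successor at which the rotor now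
    points. *)
Definition rotor_potential (k : V -> R) (u : V) (i : nat) : R :=
  \sum_(v <- take i (rotor_succ m u)) defect k u v.

(** The rotor at [b] is left out because the first-step equation is available only away from [b]. *)
Definition walk_potential (k : V -> R) (b : V) (c : V * (V -> nat)) : R :=
  k c.1 + \sum_(u | u != b) rotor_potential k u (c.2 u).

Variables (a b : V) (k : V -> R).
Hypothesis p_sum : forall u, \sum_v p u v = 1.
Hypothesis p_ba : p b a = 1.
Hypothesis k_ge0 : forall u, 0 <= k u.
Hypothesis k_b : k b = 0.
Hypothesis k_step : forall u, u != b -> k u = 1 + \sum_v p u v * k v.

Lemma sum_defect (u : V) :
  u != b -> \sum_(v <- rotor_succ m u) defect k u v = 0.
Proof.
move=> ub; rewrite sum_rotor_succ.
under eq_bigr do rewrite /defect -addrA -opprD mulrBr mulrDr mulr1.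
rewrite sumrB big_split/= -mulr_suml p_sum mul1r (k_step ub).
by rewrite [1 + _]addrC subrr mulr0.
Qed.

Lemma rotor_potential_step (u : V) (i : nat) :
  u != b -> (1 <= i <= rotor_deg m u)%N ->
  let j := if (i < rotor_deg m u)%N then i.+1 else 1%N in
  rotor_potential k u j = rotor_potential k u i + defect k u (successor m u j).
Proof.
move=> ub /andP[i0 id] j.
have potS l : (l < rotor_deg m u)%N -> rotor_potential k u l.+1 =
    rotor_potential k u l + defect k u (successor m u l.+1).
  move=> ld; rewrite /rotor_potential (take_nth u) ?size_tuple//.
  by rewrite big_rcons /= addrC.
rewrite /j; case: ltnP => [|di]; first exact: potS.
rewrite potS; last exact: rotor_deg_gt0.
congr (_ + _).
rewrite /rotor_potential take0 big_nil take_oversize ?size_tuple//.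
by rewrite sum_defect.
Qed.

(** Away from [b] the change of [k] along the step cancels against the added [defect], leaving -1.
    At [b] no counted rotor turns and the walk moves to [a], so the change is [k a - k b = k a]. *)
Lemma walk_potential_step (c : V * (V -> nat)) : rotor_config m c.2 ->
  walk_potential k b (rotor_step m c) =
  walk_potential k b c + (c.1 == b)%:R * (k a + 1) - 1.
Proof.
case: c => x r /= rc; rewrite /walk_potential /=.
set i := if _ then _ else _.
have ri : (1 <= i <= rotor_deg m x)%N.
  by rewrite /i; have [|_] := ltnP (r x) (rotor_deg m x);
    rewrite ?(rotor_deg_gt0 m).
have [xb|xb] := eqVneq x b.
  rewrite xb /= in ri *; rewrite (successor_eq1 p_ba ri) k_b.
  under eq_bigr => u ub do rewrite (negbTE ub).
  by ring.
rewrite (bigD1 x)//= [in RHS](bigD1 x)//= eqxx rotor_potential_step//.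
under eq_bigr => u /andP[_ ux] do rewrite (negbTE ux).
rewrite /defect; ring.
Qed.

Lemma walk_potentialE (x0 : V) (r0 : V -> nat) (t : nat) : rotor_config m r0 ->
  walk_potential k b (iter t (rotor_step m) (x0, r0)) =
  walk_potential k b (x0, r0)
    + (visits (rotor_walk m x0 r0) t b)%:R * (k a + 1) - t%:R.
Proof.
move=> rc; elim: t => [|t IHt]; first by rewrite visits0/=; ring.
rewrite iterS walk_potential_step; last exact: rotor_walk_config.
rewrite IHt visitsS natrD -/(rotor_walk m x0 r0 t) -(natr1 t); ring.
Qed.

(** The values of [k] lie between 0 and their maximum, which gives the first term of [K2]. Each
    rotor contributes a difference of two partial sums of a zero-sum list, at most half its total
    mass, which gives the second. *)
Lemma walk_potential_dist (c c' : V * (V -> nat)) :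
  `|walk_potential k b c - walk_potential k b c'| <= K2 m k b.
Proof.
rewrite /walk_potential opprD addrACA (le_trans (ler_normD _ _))//.
apply: lerD.
  have := (k_ge0 c.1, k_ge0 c'.1,
           le_bigmax (k b) k c.1, le_bigmax (k b) k c'.1).
  by case=> [[[]]] *; rewrite ler_norml; apply/andP; split; lra.
rewrite -sumrB (le_trans (ler_norm_sum _ _ _))// mulr_sumr.
apply: ler_sum => u ub.
rewrite (le_trans (norm_sum_take_sub _ _ (sum_defect ub)))//.
rewrite sum_rotor_succ mulr_sumr ler_pM2l ?invr_gt0//.
by under [leRHS]eq_bigr do rewrite -mulrA.
Qed.

Lemma rotor_discrepancy (x0 : V) (r0 : V -> nat) (t : nat) :
  rotor_config m r0 ->
  let n := visits (rotor_walk m x0 r0) t b in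
  (0 < n)%N -> `|(k a + 1) - t%:R / n%:R| <= K2 m k b / n%:R.
Proof.
move=> rc n n0; have nR : 0 < n%:R :> R by rewrite ltr0n.
(* After multiplication by [n] the left side is the absolute change of the potential over [t]
   steps. *)
rewrite ler_pdivlMr// -{2}(gtr0_norm nR) -normrM mulrBl divfK ?gt_eqF//.
have := walk_potential_dist (iter t (rotor_step m) (x0, r0)) (x0, r0).
rewrite walk_potentialE// -/n.
rewrite [X in `|X| <= _ -> _](_ : _ = (k a + 1) * n%:R - t%:R)//.
ring.
Qed.

End RotorPotential.

Theorem theorem2 (R : realType) (V : finType) (p : V -> V -> R)
  (p_trans : transition_probabilities p)
  (disp : measure_display) (Omega : measurableType disp)
  (P : V -> probability Omega R) (X : nat -> Omega -> V)
  (chain : markov_chain p P X)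
  (a b : V) (neq_ab : a != b) (p_ba : p b a = 1)
  (k : V -> R)
  (k_def : forall v, expected_hitting_time P X b v = (k v)%:E)
  (m : rotor_mechanism p)
  (x0 : V) (r0 : V -> nat) (r0_config : rotor_config m r0)
  (t : nat) :
  let n := visits (rotor_walk m x0 r0) t b in
  (0 < n)%N ->
  `|(k a + 1) - t%:R / n%:R| <= K2 m k b / n%:R.
Proof.
have p_ge0 u v : 0 <= p u v by case/andP: (transition_itv p_trans u v).
apply: (rotor_discrepancy (transition_sum p_trans)) => //.
- move=> u; rewrite -lee_fin -k_def.
  exact: expected_hitting_time_ge0 _ p_ge0 chain u.
- apply: EFin_inj; rewrite -k_def (expected_hitting_timeE _ p_ge0 chain).
  by rewrite eqxx.
(* Since all values of [k] are finite, the first-step equation descends from the extended reals to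
   [R]. *)
- move=> u ub; apply: EFin_inj.
  rewrite -k_def (expected_hitting_time_step p_ge0 chain ub) EFinD -sumEFin.
  by congr (_ + _)%E; apply: eq_bigr => v _; rewrite k_def.
Qed.
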